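(* Let $G$ be a finite group, let $*$ be a nonidentical involutory antiautomorphism of $G$ with $gg^*\in Z(G)$ for every $g\in G$, and let $g_0\in Z(G)$ with $g_0^*=g_0$. Let $\beta\in\{xy,\,x^*y,\,yx,\,yx^*\}$, $\gamma\in\{xy,\,yx\}$ and $\delta\in\{g_0xy,\,g_0xy^*,\,g_0x^*y,\,g_0x^*y^*,\,g_0yx,\,g_0yx^*,\,g_0y^*x,\,g_0y^*x^*\}$. Then the loop $L=Q(G,*,g_0,\beta,\gamma,\delta)$ is extra if and only if at least one of the following holds: (a) $L$ is associative; (b) $G/Z(G)$ is an elementary abelian $2$-group and $(\beta,\gamma,\delta)=(x^*y,yx,g_0yx^* )$.
   Context: $Z(G)$ is the center of $G$. An involutory antiautomorphism $*$ of $G$ satisfies $(g^* )^*=g$ and $(gh)^*=h^*g^*$; nonidentical means $g^*\neq g$ for some $g\in G$. A word such as $yx^*$ or $g_0y^*x$ denotes the function $G\times G\to G$ sending $(x,y)$ to the value of the word. Words are regarded as functions: two words are identified when they define the same function on $G\times G$ (for instance $xy$ and $yx$ when $G$ is commutative), and equality of triples $(\beta,\gamma,\delta)$ means equality of the three functions. Let $Gu=\{gu : g\in G\}$ be a disjoint copy of $G$. The loop $Q(G,*,g_0,\beta,\gamma,\delta)$ is the set $G\cup Gu$ with the multiplication, for $x,y\in G$, $$x\circ y=xy,\quad x\circ yu=\beta(x,y)u,\quad xu\circ y=\gamma(x,y)u,\quad xu\circ yu=\delta(x,y).$$ It is a loop with neutral element $1\in G$. The trivial group counts as an elementary abelian $2$-group.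 A loop is extra if it satisfies $x(y(zx))=((xy)z)x$. *)

(* Defs.v *)
From HB Require Import structures.
From mathcomp Require Import all_boot all_fingroup all_solvable.

Set Implicit Arguments.
Unset Strict Implicit.
Unset Printing Implicit Defensive.

Local Open Scope group_scope.

Section Loops.
Variables (T : Type) (op : T -> T -> T) (e : T).

Definition is_loop : Prop :=
  [/\ left_id e op, right_id e op,
      forall a b, exists! x, op a x = b
    & forall a b, exists! y, op y a = b].

Definition extra_loop : Prop :=
  is_loop /\ (forall x y z, op x (op y (op z x)) = op (op (op x y) z) x).

End Loops.

Definition involutory_antiautomorphism (gT : finGroupType) (star : gT -> gT) :
  Prop :=
  involutive star /\ (forall g h, star (g * h) = star h * star g).

(* A word in x and y is identified with the finite function it defines, so that
   Leibniz equality of words is equality of functions on gT * gT; e.g. the words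
   x y and y x are the same element when gT is commutative. *)
Definition word (gT : finGroupType) (w : gT -> gT -> gT) :
  {ffun gT * gT -> gT} := [ffun p => w p.1 p.2].

Section Words.
Variables (gT : finGroupType) (star : gT -> gT) (g0 : gT).
Local Notation "x ^*" := (star x).

Definition beta_words : seq {ffun gT * gT -> gT} :=
  [:: word (fun x y => x * y);
      word (fun x y => x^* * y);
      word (fun x y => y * x);
      word (fun x y => y * x^*)].

Definition gamma_words : seq {ffun gT * gT -> gT} :=
  [:: word (fun x y => x * y);
      word (fun x y => y * x)].

Definition delta_words : seq {ffun gT * gT -> gT} :=
  [:: word (fun x y => g0 * x * y);
      word (fun x y => g0 * x * y^*);
      word (fun x y => g0 * x^* * y);
      word (fun x y => g0 * x^* * y^*);
      word (fun x y => g0 * y * x);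
      word (fun x y => g0 * y * x^*);
      word (fun x y => g0 * y^* * x);
      word (fun x y => g0 * y^* * x^*)].

End Words.

(* The disjoint union of G and G u: inl x stands for x, inr x for x u. *)
Definition Qloop (gT : finGroupType) : Type := (gT + gT)%type.

(* The product does not mention star and g0 explicitly: they only enter through
   the words beta, gamma, delta. *)
Definition Qmul (gT : finGroupType) (beta gamma delta : {ffun gT * gT -> gT})
    (a b : Qloop gT) : Qloop gT :=
  match a, b with
  | inl x, inl y => inl (x * y)
  | inl x, inr y => inr (beta (x, y))
  | inr x, inl y => inr (gamma (x, y))
  | inr x, inr y => inl (delta (x, y))
  end.

Definition Qone (gT : finGroupType) : Qloop gT := inl 1.

(* Main.v *)
Require Import Defs.
From HB Require Import structures.
From mathcomp Require Import all_boot all_fingroup all_solvable.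

(** Evaluating the extra identity on triples with one entry in [Gu] leaves, up
    to equality of functions, only two possibilities for the first two words:
    [beta = gamma = xy], or [beta = x^* y], [gamma = yx] together with
    [a^* c a = a c a^*] for all [a], [c].  As [a a^*] is central, the latter
    condition says that all squares of [G] are central.  A triple with two
    entries in [Gu] then gives [delta(b, c)] in terms of [delta(1, b)], which
    is [g0 b] or [g0 b^*]; since [*] is nonidentical only one choice survives:
    [delta = g0 xy] in the first case, where [L] is a group, and
    [delta = g0 y x^*] in the second. *)

Local Open Scope group_scope.

Lemma finite_loop (T : finType) (op : T -> T -> T) (e : T) :
    left_id e op -> right_id e op ->
    (forall a, injective (op a)) -> (forall a, injective (op^~ a)) ->
  is_loop op e.
Proof.
move=> op1x opx1 injl injr.
have sol (f : T -> T) (b : T) : injective f -> exists! x, f x = b.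
  move=> injf; exists (invF injf b); split; first exact: f_invF.
  by move=> x <-; exact: invF_f.
by split=> // a b; [exact: (sol (op a)) | exact: (sol (op^~ a))].
Qed.

(** * Central squares and the quotient by the center *)

Section Quotient.
Variable gT : finGroupType.
Local Notation Z := 'Z([set: gT]).

Lemma centerTP (z : gT) : reflect (forall g, commute z g) (z \in Z).
Proof.
apply: (iffP (centerP _ _)) => [[_ zC] g | zC]; first exact: zC (in_setT g).
by split=> [|g _]; [exact: in_setT | exact: zC].
Qed.

(** Exponent 2 already forces commutativity: when every element is its own inverse,
    [x y = (x y)^-1 = y^-1 x^-1 = y x]. *)
Lemma abelem2_quotient_center :
  2.-abelem ([set: gT] / Z) <-> forall x : gT, x ^+ 2 \in Z.
Proof.
have nZ x : x \in 'N(Z) by rewrite (subsetP (normal_norm (center_normal _))).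
split=> [abZ x | sqZ].
  apply: coset_idr; first exact: groupX.
  rewrite morphX //; case/abelemP: abZ => // _; apply.
  exact/mem_quotient/in_setT.
have sq1 : {in [set: gT] / Z, forall y, y ^+ 2 = 1}.
  by move=> _ /morphimP[x nx _ ->]; rewrite -morphX //; apply: coset_id.
apply/abelemP=> //; split=> //; apply/centsP=> x Gx y Gy.
have invK z : z \in [set: gT] / Z -> z^-1 = z.
  by move=> Gz; apply: (mulgI z); rewrite mulgV -expg2 sq1.
by rewrite /commute -[x * y]invK ?groupM // invMg !invK.
Qed.

End Quotient.

(** * The antiautomorphism and the two surviving triples of words *)

Section Classification.
Set Implicit Arguments.
Unset Strict Implicit.
Variables (gT : finGroupType) (star : gT -> gT) (g0 : gT).
Hypothesis star_antiaut : involutory_antiautomorphism star.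
Hypothesis star_central : forall g : gT, g * star g \in 'Z([set: gT]).
Hypothesis g0_central : g0 \in 'Z([set: gT]).
Local Notation "x ^*" := (star x).

Lemma starK : involutive star. Proof. by case: star_antiaut. Qed.
Lemma starM g h : (g * h)^* = h^* * g^*. Proof. by case: star_antiaut. Qed.
Lemma star_inj : injective star. Proof. exact: inv_inj starK. Qed.
Lemma star1 : 1^* = 1.
Proof. by apply: (mulgI 1^*); rewrite -starM !mulg1. Qed.

Lemma mulg_starC x : x * x^* = x^* * x.
Proof.
apply: (mulgI x).
by rewrite [RHS]mulgA (centerTP _ _ (star_central x)).
Qed.

(** With [n = a a^*] central, [a^* = n a^-1], so the two sides are [n a^-1 c a] and [n a c a^-1].
    They agree for every [c] exactly when [a^2] commutes with every [c]. *)
Lemma twisted_square_central :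
  (forall a c, a^* * c * a = a * c * a^* ) <->
  (forall a : gT, a ^+ 2 \in 'Z([set: gT])).
Proof.
split=> [starC a | sqC a c].
  apply/centerTP=> c; apply: (mulgI (a * a^* )).
  have -> : a * a^* * (c * a ^+ 2) = a * (a^* * c * a) * a by rewrite !mulgA.
  rewrite starC (centerTP _ _ (star_central a)).
  by rewrite [in LHS]mulg_starC expg2 !mulgA.
have nC := centerTP _ _ (star_central a).
have aC := centerTP _ _ (sqC a).
rewrite /commute expg2 in aC; rewrite /commute in nC.
apply: (mulgI a); rewrite !mulgA nC aC -!mulgA; congr (c * _).
by rewrite -mulg_starC.
Qed.

Lemma g0C g : g0 * g = g * g0. Proof. exact: centerTP g0_central g. Qed.

(** Here [u] becomes a central element with [u^2 = g0], adjoined to the group [G]; centrality of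
    [g0] is what makes this consistent. *)
Lemma group_words_assoc :
  associative (Qmul (word (fun x y => x * y)) (word (fun x y => x * y))
                    (word (fun x y => g0 * x * y))).
Proof.
by case=> a [] b [] c /=; rewrite ?ffunE /= ?mulgA // -?g0C ?mulgA.
Qed.

Lemma twisted_words_extra (g0_star : g0^* = g0)
    (starC : forall a c, a^* * c * a = a * c * a^* ) :
  let op := Qmul (word (fun x y => x^* * y)) (word (fun x y => y * x))
                 (word (fun x y => g0 * y * x^* )) in
  forall x y z : Qloop gT, op x (op y (op z x)) = op (op (op x y) z) x.
Proof.
have nC a g : commute (a * a^* ) g := centerTP _ _ (star_central a) g.
have sqC a : a ^+ 2 \in 'Z([set: gT]) := iffLR twisted_square_central starC a.
have {}sqC a g : commute (a ^+ 2) g := centerTP _ _ (sqC a) g.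
(* Of the eight cases, [(a, b, c u)] and [(a, b u, c)] are instances of [starC], [(a, b u, c u)]
   needs [a^2] central, and [(a u, b, c)] needs [a a^*] central. The first is associativity in [G],
   and the last three only move [g0]. *)
move=> op [] a [] b [] c; rewrite /op /= ?ffunE /= ?starM ?starK ?g0_star.
- by rewrite !mulgA.
- by rewrite !mulgA starC.
- by rewrite !mulgA starC.
- rewrite !mulgA -g0C -!mulgA; congr (inl (g0 * _)).
  by rewrite mulgA -expg2 sqC expg2 !mulgA.
- by rewrite -!mulgA; congr (inl (g0 * _)); rewrite [RHS]mulgA nC !mulgA.
- by rewrite -[g0 * a * _]mulgA g0C !mulgA.
- by rewrite -!mulgA g0C -!mulgA -[a * g0]g0C.
- rewrite -!mulgA; congr (inl (g0 * _)).
  by rewrite !mulgA g0C -[a * g0 * _]mulgA g0C !mulgA.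
Qed.

(** * The loop property for all triples of words *)

Section LoopOfWords.
Variables beta gamma delta : {ffun gT * gT -> gT}.
Hypothesis beta_word : beta \in beta_words star.
Hypothesis gamma_word : gamma \in gamma_words gT.
Hypothesis delta_word : delta \in delta_words star g0.

(** In each variable separately, a word is a composite of translations and possibly the star, all
    injective; they are peeled off one at a time. *)
Local Ltac cancel_words :=
  rewrite !ffunE /=;
  repeat first [exact: id | move/mulgI | move/mulIg | move/star_inj].

Lemma beta_inj : (forall x, injective (fun y => beta (x, y))) /\
                 (forall y, injective (fun x => beta (x, y))).
Proof.
by split; move: beta_word; rewrite !inE; do ![case/orP]; move/eqP->;
  move=> z x y /=; cancel_words.
Qed.

Lemma gamma_inj : (forall x, injective (fun y => gamma (x, y))) /\
                  (forall y, injective (fun x => gamma (x, y))).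
Proof.
by split; move: gamma_word; rewrite !inE; do ![case/orP]; move/eqP->;
  move=> z x y /=; cancel_words.
Qed.

Lemma delta_inj : (forall x, injective (fun y => delta (x, y))) /\
                  (forall y, injective (fun x => delta (x, y))).
Proof.
by split; move: delta_word; rewrite !inE; do ![case/orP]; move/eqP->;
  move=> z x y /=; cancel_words.
Qed.

Lemma Qmul_loop : is_loop (Qmul beta gamma delta) (Qone gT).
Proof.
have [bl br] := beta_inj; have [cl cr] := gamma_inj; have [dl dr] := delta_inj.
apply: finite_loop => [[x|x]|[x|x]|[a|a] [x|x] [y|y]|[a|a] [x|x] [y|y]] //=.
- by rewrite mul1g.
- move: beta_word; rewrite !inE; do ![case/orP]; move/eqP->;
  by rewrite ffunE /= ?star1 ?mul1g ?mulg1.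
- by rewrite mulg1.
- move: gamma_word; rewrite !inE; case/orP; move/eqP->;
  by rewrite ffunE /= ?mul1g ?mulg1.
- by case=> /mulgI->.
- by case=> /bl->.
- by case=> /cl->.
- by case=> /dl->.
- by case=> /mulIg->.
- by case=> /cr->.
- by case=> /br->.
- by case=> /dr->.
Qed.

(** * Words forced by the extra identity *)

Section Extra.
Hypothesis extra : forall x y z : Qloop gT,
  let op := Qmul beta gamma delta in
  op x (op y (op z x)) = op (op (op x y) z) x.

Lemma extra_beta_gamma :
  (beta = word (fun x y => x * y) /\ gamma = word (fun x y => x * y)) \/
  [/\ beta = word (fun x y => x^* * y), gamma = word (fun x y => y * x)
    & forall a c, a^* * c * a = a * c * a^* ].
Proof.
have EGuG a b c : beta (a, gamma (b, c * a)) = gamma (gamma (beta (a, b), c), a).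
  by case: (extra (inl a) (inr b) (inl c)).
have EGGu a b c : beta (a, beta (b, gamma (c, a))) = gamma (beta (a * b, c), a).
  by case: (extra (inl a) (inl b) (inr c)).
(* Over a commutative group several words define the same function, which merges the degenerate
   pairs below into the two of the conclusion. *)
have starC_of_comm : (forall x y : gT, x * y = y * x) ->
    forall a c, a^* * c * a = a * c * a^*.
  by move=> C a c; rewrite -mulgA C [c * a]C.
have yx_xy : (forall x y : gT, x * y = y * x) ->
    word (fun x y : gT => y * x) = word (fun x y => x * y).
  by move=> C; apply/ffunP=> -[x y]; rewrite !ffunE C.
have yxs_xsy : (forall x y : gT, x * y = y * x) ->
    word (fun x y : gT => y * x^* ) = word (fun x y => x^* * y).
  by move=> C; apply/ffunP=> -[x y]; rewrite !ffunE C.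
(* Of the eight pairs, all but [(xy, xy)] and [(x^* y, yx)] force [G] to be commutative, through a
   specialization with one entry equal to 1. *)
move: beta_word gamma_word; rewrite !inE; do ![case/orP]; move/eqP=> eb;
  do ![case/orP]; move/eqP=> eg; rewrite {}eb {}eg in EGuG EGGu *.
- by left.
- have C (x y : gT) : x * y = y * x.
    by have := EGGu x y 1; rewrite !ffunE /= !mulg1 => /mulgI ->.
  by left; rewrite yx_xy.
- have C (x y : gT) : x * y = y * x.
    have := EGGu x^* y^* 1; rewrite !ffunE /= starM !starK !mulg1 mul1g.
    by rewrite mulgA => /mulIg.
  right; split; rewrite ?yx_xy //; exact: starC_of_comm.
- right; split=> // a c.
  by have := EGuG a 1 c; rewrite !ffunE /= !mulg1 !mulgA.
- have C (x y : gT) : x * y = y * x.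
    by have := EGuG x 1 y; rewrite !ffunE /= !mul1g => /mulIg ->.
  by left; rewrite yx_xy.
- have C (x y : gT) : x * y = y * x.
    have := EGuG x 1 y.
    by rewrite !ffunE /= !mulg1 mul1g mulgA => /mulIg ->.
  by left; rewrite yx_xy.
- have C (x y : gT) : x * y = y * x.
    have := EGuG x^* 1 y; rewrite !ffunE /= starK !mul1g.
    by rewrite -mulgA -mulg_starC mulgA => /mulIg ->.
  right; split; rewrite ?yx_xy ?yxs_xsy //; exact: starC_of_comm.
- have C (x y : gT) : x * y = y * x.
    have := EGuG x 1 y.
    by rewrite !ffunE /= !mulg1 mul1g mulgA => /mulIg ->.
  right; split; rewrite ?yxs_xsy //; exact: starC_of_comm.
Qed.

Hypothesis star_nonid : exists g : gT, g^* <> g.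
Hypothesis g0_star : g0^* = g0.

(** At [x = 1] neither the order of the factors nor a star on [x] is visible, so eight words leave
    two functions. *)
Lemma delta1_word :
  (forall y, delta (1, y) = g0 * y) \/ (forall y, delta (1, y) = g0 * y^* ).
Proof.
move: delta_word; rewrite !inE; do ![case/orP]; move/eqP->;
  by [left=> y; rewrite ffunE /= ?star1 ?mulg1
    | right=> y; rewrite ffunE /= ?star1 ?mulg1].
Qed.

Lemma extra_delta_group :
    beta = word (fun x y => x * y) -> gamma = word (fun x y => x * y) ->
  delta = word (fun x y => g0 * x * y).
Proof.
move=> eb eg.
have EuuG a b c : a * delta (b, c * a) = delta (a, b) * c * a.
  by case: (extra (inr a) (inr b) (inl c)); rewrite eb eg !ffunE.
have D b c : delta (b, c) = delta (1, b) * c.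
  by rewrite -[LHS]mul1g -{1}[c]mulg1 EuuG mulg1.
case: delta1_word => D1.
  by apply/ffunP=> -[b c]; rewrite ffunE D D1.
(* If [delta(1, y)] is [g0 y^*], then [D] at [b = 1] gives [g0 g^* = g0 g], against the choice of
   [g]. *)
have [g []] := star_nonid.
by have := D 1 g; rewrite !D1 star1 mulg1 => /mulgI.
Qed.

Lemma extra_delta_twisted :
    beta = word (fun x y => x^* * y) -> gamma = word (fun x y => y * x) ->
  delta = word (fun x y => g0 * y * x^* ).
Proof.
move=> eb eg.
have EuuG a b c : delta (b, c^* * a) * a = (delta (a, b) * c)^* * a.
  by case: (extra (inr a) (inr b) (inl c)); rewrite eb eg !ffunE.
have D b c : delta (b, c) = c * (delta (1, b))^*.
  (* The third entry is starred so that the star coming from [beta] cancels. *)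
  by have := EuuG 1 b c^*; rewrite !mulg1 starK starM starK.
case: delta1_word => D1.
  by apply/ffunP=> -[b c]; rewrite ffunE D D1 starM g0_star mulgA -g0C mulgA.
(* As before, [D] at [b = 1] would give [g0 g^* = g g0]; since [g0] is central, [g] would be fixed
   by the star. *)
have [g []] := star_nonid.
by have := D 1 g; rewrite !D1 star1 mulg1 g0_star -g0C => /mulgI.
Qed.

End Extra.

End LoopOfWords.

End Classification.

Theorem theorem8p2 (gT : finGroupType) (star : gT -> gT) (g0 : gT)
    (beta gamma delta : {ffun gT * gT -> gT})
    (star_antiaut : involutory_antiautomorphism star)
    (star_nonid : exists g : gT, star g <> g)
    (star_central : forall g : gT, g * star g \in 'Z([set: gT]))
    (g0_central : g0 \in 'Z([set: gT]))
    (g0_star : star g0 = g0)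
    (beta_word : beta \in beta_words star)
    (gamma_word : gamma \in gamma_words gT)
    (delta_word : delta \in delta_words star g0) :
  extra_loop (Qmul beta gamma delta) (Qone gT) <->
  (associative (Qmul beta gamma delta) \/
   (2.-abelem ([set: gT] / 'Z([set: gT])) /\
    (beta, gamma, delta) =
      (word (fun x y : gT => star x * y),
       word (fun x y : gT => y * x),
       word (fun x y : gT => g0 * y * star x)))).
Proof.
have squares := twisted_square_central star_central.
split=> [[_ extra] | hyp].
  have [[eb eg] | [eb eg starC]] := extra_beta_gamma star_antiaut star_central
    beta_word gamma_word extra.
    left; rewrite (extra_delta_group star_antiaut delta_word extra
      star_nonid eb eg) eb eg.
    exact: group_words_assoc.
  right; split; first by apply/abelem2_quotient_center/squares.
  by rewrite (extra_delta_twisted star_antiaut g0_central delta_word extra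
    star_nonid g0_star eb eg) eb eg.
split; first exact: (Qmul_loop star_antiaut beta_word gamma_word delta_word).
case: hyp => [assoc x y z | [abZ [-> -> ->]]]; first by rewrite !assoc.
apply: twisted_words_extra => //.
by apply/squares/abelem2_quotient_center.
Qed.
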